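(* Let $X$ be a compact Hausdorff space, with $\mathscr{U}$ the unique uniformity inducing its topology, and let $f \colon X \to X$ be a continuous function. The system $(X,f)$ is minimal if and only if for any $E \in \mathscr{U}$ there exist $D \in \mathscr{U}$ and $n \in \mathbb{N}$ such that for any two $D$-pseudo-orbits $(x_i)_{i \geq 0}$ and $(y_i)_{i \geq 0}$ \[\{y_i\}_{i =0}^n \subseteq B_E\left( \{x_i\}_{i=0}^n\right)\] and \[\{x_i\}_{i =0}^n \subseteq B_E\left( \{y_i\}_{i=0}^n\right).\]
   Context: $X$ is nonempty. A compact Hausdorff space has a unique uniformity $\mathscr{U}$ inducing its topology. Since symmetric entourages form a base for $\mathscr{U}$, all entourages referred to are taken to be symmetric ($E=E^{-1}$). For $E\in\mathscr{U}$, $x\in X$ and $A\subseteq X$: $B_E(x)=\{y\in X \mid (x,y)\in E\}$ and $B_E(A)=\bigcup_{x\in A}B_E(x)$. For $D\in\mathscr{U}$, a $D$-pseudo-orbit is a sequence $(x_i)_{i\ge 0}$ in $X$ with $(f(x_i),x_{i+1})\in D$ for all $i\ge 0$. A subset $A\subseteq X$ is positively invariant if $f(A)\subseteq A$. The system $(X,f)$ is minimal if there are no proper, nonempty, closed, positively invariant subsets of $X$; equivalently, if $\omega(x)=X$ for all $x\in X$, where $\omega(x)=\bigcap_{N\in\mathbb{N}}\overline{\{f^n(x)\mid n>N\}}$. *)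

(* Defs.v *)
From mathcomp Require Import all_boot all_order all_algebra.
From mathcomp Require Import all_classical.
From mathcomp Require Import topology.

Set Implicit Arguments.
Unset Strict Implicit.
Unset Printing Implicit Defensive.

Local Open Scope classical_set_scope.

(* In a [uniformType] the entourages induce the topology by construction. When
   the space is compact Hausdorff they therefore form the unique compatible
   uniformity. *)

Definition symmetric_entourage (X : uniformType) (E : set (X * X)) : Prop :=
  entourage E /\ (E^-1)%relation = E.

Definition ent_ball (X : Type) (E : set (X * X)) (A : set X) : set X :=
  \bigcup_(x in A) xsection E x.

Definition pseudo_orbit (X : Type) (f : X -> X) (D : set (X * X))
    (x : nat -> X) : Prop :=
  forall i : nat, D (f (x i), x i.+1).

Definition initial_segment (X : Type) (x : nat -> X) (n : nat) : set X :=
  [set x i | i in [set i : nat | (i <= n)%N]].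

Definition positively_invariant (X : Type) (f : X -> X) (A : set X) : Prop :=
  f @` A `<=` A.

Definition minimal_system (X : topologicalType) (f : X -> X) : Prop :=
  ~ exists A : set X,
      [/\ A `<` [set: X], A !=set0, closed A & positively_invariant f A].

(* Main.v *)
Require Import Defs.
From mathcomp Require Import all_boot all_order all_algebra.
From mathcomp Require Import all_classical.
From mathcomp Require Import topology.

Local Open Scope classical_set_scope.

(** If a proper nonempty closed positively invariant set [A] exists, pick [z]
outside [A] and an entourage [E] whose ball at [z] misses [A].  The orbits of
[z] and of a point of [A] are pseudo-orbits for every [D], and the point [z] of
the first one is not [E]-close to any point of the second, which stays in [A].

Conversely, in a minimal system every orbit meets every nonempty open set
([minimal_orbit_meets]).  A pseudo-orbit with a small error starting close to
[x] is close to the orbit of [x] at any prescribed time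
([pseudo_orbit_tracking]), so around each pair [(x, z)] there are neighbourhoods
such that all fine enough pseudo-orbits starting near [x] come [E]-close to all
points near [z] by some bounded time.  Compactness in both variables makes the
error and the time bound uniform ([minimal_pseudo_orbit_dense]): the initial
segment of every [D]-pseudo-orbit is then [E]-dense in the whole space, which is
stronger than the two inclusions wanted. *)

Lemma entourage_proper (X : uniformType) (x : X) :
  ProperFilter (@entourage X).
Proof.
apply: Build_ProperFilter_ex => E entE.
by exists (x, x); exact: entourage_refl.
Qed.

Lemma orbit_pseudo_orbit (X : uniformType) (f : X -> X) (D : set (X * X))
    (x : X) :
  entourage D -> pseudo_orbit f D (fun i => iter i f x).
Proof. by move=> entD i; rewrite iterS; exact: entourage_refl. Qed.

Lemma pseudo_orbitS (X : Type) (f : X -> X) (D D' : set (X * X))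
    (x : nat -> X) :
  D `<=` D' -> pseudo_orbit f D x -> pseudo_orbit f D' x.
Proof. by move=> DD' xD i; exact/DD'/xD. Qed.

Lemma positively_invariant_iter (X : Type) (f : X -> X) (A : set X) (x : X)
    (n : nat) :
  positively_invariant f A -> A x -> A (iter n f x).
Proof.
by move=> fA Ax; elim: n => //= n IHn; apply: fA; exists (iter n f x).
Qed.

(** Every orbit of a minimal system is dense, its closure being invariant. *)
Lemma minimal_orbit_meets (X : topologicalType) (f : X -> X) :
  continuous f -> minimal_system f ->
  forall (x z : X) (U : set X), nbhs z U -> exists k, U (iter k f x).
Proof.
move=> cf minf x z U zU.
pose A := closure (range (fun k => iter k f x)).
have [Az|nAz] := pselect (A z).
  by have [_ [[k _ <-] Uk]] := Az U zU; exists k.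
case: minf; exists A; split; last first.
- move=> _ [p Ap <-] V fpV.
  have [_ [[k _ <-] Vk]] := Ap _ (cf p V fpV).
  by exists (f (iter k f x)); split => //; exists k.+1.
- exact: closed_closure.
- by exists x; apply: subset_closure; exists 0%N.
- by split=> // TA; exact/nAz/TA.
Qed.

(** Pseudo-orbits follow orbits up to a fixed time, uniformly in the starting
point near [x] and in the error of the pseudo-orbit. *)
Lemma pseudo_orbit_tracking (X : uniformType) (f : X -> X) (k : nat) (x : X)
    (U : set X) :
  continuous f -> nbhs (iter k f x) U ->
  \forall x' \near x & D \near powerset_filter_from (@entourage X),
    forall y, pseudo_orbit f D y -> y 0%N = x' -> U (y k).
Proof.
move=> cf; have entF := entourage_proper X x.
elim: k U => [|k IHk] U.
  by move=> /= xU; near=> x' D => y _ ->; exact: (near xU x').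
rewrite iterS -nbhs_entourageE => -[E entE EU].
have splitU : nbhs (iter k f x)
    (f @^-1` xsection (split_ent E) (f (iter k f x))).
  exact/cf/nbhs_entourage/entourage_split_ent.
have [[V W] /= [xV smallW] VW] := IHk _ splitU.
have subE := small_set_sub (entourage_split_ent entE).
near=> x' D => y yD yx'.
apply/EU/xsectionP/(entourage_split (f (y k))) => //.
  apply/xsectionP.
  have Vx' : V x' by exact: (near xV x').
  have WD : W D by exact: (near smallW D).
  exact: (VW (x', D) (conj Vx' WD) y yD yx').
have DE : D `<=` split_ent E by exact: (near subE D).
exact/DE/yD.
Unshelve. all: by end_near. Qed.

(** In a compact minimal system, the initial segments of some length of all fine
enough pseudo-orbits are [E]-dense in the whole space. *)
Lemma minimal_pseudo_orbit_dense (X : uniformType) (f : X -> X)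
    (E : set (X * X)) :
  [set: X] !=set0 -> compact [set: X] -> continuous f -> minimal_system f ->
  entourage E ->
  exists (D : set (X * X)) (n : nat), entourage D /\
    forall y, pseudo_orbit f D y -> forall z,
      exists2 k, (k <= n)%N & E (y k, z).
Proof.
move=> [x0 _] compactX cf minf entE; have entF := entourage_proper X x0.
pose F := filter_prod (powerset_filter_from (@entourage X)) \oo.
pose P (Dn : set (X * X) * nat) (xz : X * X) :=
  forall y, pseudo_orbit f Dn.1 y -> y 0%N = xz.1 ->
    exists2 k, (k <= Dn.2)%N & E (y k, xz.2).
have compactXX : compact [set: X * X].
  by rewrite -setXTT; exact: compact_setX.
(* By compactness of [X * X], it is enough to treat the pairs near each given
   pair, for all fine enough [D] and all large enough [n]. *)
have : \forall Dn \near F, [set: X * X] `<=` P Dn.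
  move/compact_near_coveringP : compactXX; apply => -[x z] _.
  pose S := split_ent E.
  have entS : entourage S by exact: entourage_split_ent.
  (* Membership in an interior says that the set is a neighbourhood, so [Sk] is
     the hypothesis that the tracking lemma requires. *)
  have [k Sk] := minimal_orbit_meets X f cf minf x z _
    (nbhs_interior (nbhs_entourage z (entourage_inv entS))).
  have [[V W] /= [xV smallW] VW] := pseudo_orbit_tracking X f k x _ cf Sk.
  exists (V `*` xsection S z, W `*` [set n | (k <= n)%N]) => /=.
    split; last by exists (W, [set n | (k <= n)%N]) => //; split => //; exists k.
    exists (V, xsection S z) => //; split => //.
    exact: nbhs_entourage.
  move=> [[x' z'] [D n]] /= [[Vx' /xsectionP Szz'] [WD kn]] y /= yD yx'.
  exists k => //; apply: (entourage_split z) => //.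
  by have /xsectionP := VW (x', D) (conj Vx' WD) y yD yx'.
case=> -[W N] /= [[M [MF _ [D MD]] MW] [n _ nN]] WNP.
exists D, n; split; first exact: MF.
move=> y yD z; apply: (WNP (D, n) _ (y 0%N, z)) => //.
by split; [exact: MW|apply: nN; exact: leqnn].
Qed.

Theorem theorem2p5 (X : uniformType) (f : X -> X)
  (X_nonempty : [set: X] !=set0)
  (X_compact : compact [set: X])
  (X_hausdorff : hausdorff_space X)
  (f_continuous : continuous f) :
  minimal_system f <->
  (forall E : set (X * X), symmetric_entourage E ->
    exists (D : set (X * X)) (n : nat),
      symmetric_entourage D /\
      forall x y : nat -> X, pseudo_orbit f D x -> pseudo_orbit f D y ->
        initial_segment y n `<=` ent_ball E (initial_segment x n) /\
        initial_segment x n `<=` ent_ball E (initial_segment y n)).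
Proof.
split=> [minf E [entE _]|tracking [A [[_ nTA] [a Aa] closedA fA]]].
  have [D [n [entD Dn]]] :=
    minimal_pseudo_orbit_dense X f E X_nonempty X_compact
      f_continuous minf entE.
  have dense x : pseudo_orbit f D x ->
      [set: X] `<=` ent_ball E (initial_segment x n).
    move=> xD z _; have [k kn Ekz] := Dn x xD z.
    by exists (x k); [exists k|exact/xsectionP].
  exists (D `&` D^-1)%relation, n; split.
    split; first exact: entourage_invI.
    by apply/seteqP; split=> -[p q] [].
  by move=> x y /(pseudo_orbitS _ _ _ D _ (@subIsetl _ _ _)) /dense xX
    /(pseudo_orbitS _ _ _ D _ (@subIsetl _ _ _)) /dense yX; split=> z _;
    [exact: xX|exact: yX].
have [z nAz] : exists z, ~ A z.
  by apply/existsNP => allA; apply: nTA => z _; exact: allA.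
have : nbhs z (~` A) by apply: open_nbhs_nbhs; split; first exact: closed_openC.
rewrite -nbhs_entourageE => -[E0 entE0 E0A].
pose E := (E0 `&` E0^-1)%relation.
have [|D [n [[entD _] Dn]]] := tracking E.
  split; first exact: entourage_invI.
  by apply/seteqP; split=> -[p q] [].
have [+ _] := Dn _ _ (orbit_pseudo_orbit _ f D a entD)
                     (orbit_pseudo_orbit _ f D z entD).
move=> /(_ z); case; first by exists 0%N.
move=> _ [i _ <-] /xsectionP [_ /= Ezi].
by apply: (E0A (iter i f a)); [exact/xsectionP|exact: positively_invariant_iter].
Qed.
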